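(* For every integer $k\geq 1$, every tournament of minimum out-degree at least $\dfrac{k^2+4k-3}{2}$ contains $k$ pairwise vertex-disjoint directed cycles whose lengths are pairwise different.
   Context: Tournaments are finite. The length of a directed cycle is its number of vertices. *)

(* Defs.v *)
From mathcomp Require Import all_boot all_order all_algebra.

Set Implicit Arguments.
Unset Strict Implicit.
Unset Printing Implicit Defensive.

Definition tournament (T : finType) (e : rel T) : Prop :=
  irreflexive e /\ (forall x y : T, x != y -> e x y (+) e y x).

Definition outdeg (T : finType) (e : rel T) (x : T) : nat := #|[set y | e x y]|.

(* Out-degrees are at most #|T|, so the default value #|T| does not affect the
   minimum when T is nonempty; on an empty T the minimum is 0 by convention. *)
Definition min_outdeg (T : finType) (e : rel T) : nat :=
  \big[minn/#|T|]_(x : T) outdeg e x.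

(* A directed cycle is listed from one of its vertices, in cyclic order. The
   empty sequence satisfies [cycle e] and has to be excluded; the length is
   [size c]. *)
Definition dicycle (T : finType) (e : rel T) (c : seq T) : bool :=
  [&& c != [::], cycle e c & uniq c].

(* Main.v *)
Require Import Defs.
From mathcomp Require Import all_boot all_order all_algebra.
From mathcomp Require Import zify.

(* Disjoint cycles of lengths 3, 4, ..., k + 2 are chosen greedily, shortest
   first. Once those of lengths 3, ..., j + 1 are removed, the minimum out-degree
   is still at least (k^2 + 4k - 3) / 2 - (j^2 + 3j - 4) / 2 >= (j + 1) / 2. A
   minimal nonempty vertex set inducing minimum out-degree d is strongly
   connected and has at least 2d + 1 vertices, so by Moon's theorem it contains
   cycles of all lengths from 3 to 2d + 1; for 2d >= j + 1 this includes the
   length j + 2. *)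

Set Implicit Arguments.
Unset Strict Implicit.
Unset Printing Implicit Defensive.

Import Order.TTheory GRing.Theory Num.Theory.

Section Tournament.

Variables (T : finType) (e : rel T).
Hypothesis he : tournament e.

Lemma tournament_irr x : e x x = false.
Proof. by have [-> _] := he. Qed.

Lemma tournament_neq x y : e x y -> x != y.
Proof. by apply: contraTneq => ->; rewrite tournament_irr. Qed.

Lemma tournament_asym x y : e x y -> e y x = false.
Proof.
move=> exy; have [_ /(_ x y (tournament_neq exy))] := he.
by rewrite exy; case: (e y x).
Qed.

Lemma tournament_total x y : x != y -> ~~ e x y -> e y x.
Proof. by move=> xy; have [_ /(_ x y xy)] := he; case: (e x y). Qed.

Definition outdeg_in (B : {set T}) x := #|[set y in B | e x y]|.

(** The empty set is excluded, since it would otherwise be the only inclusion-minimal such set. *)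
Definition min_outdeg_in_ge d (B : {set T}) :=
  (B != set0) && [forall x in B, d <= outdeg_in B x].

(** Strong connectivity in cut form, which the arguments below apply directly, without paths. *)
Definition strong (B : {set T}) :=
  forall S : {set T}, S \subset B -> S != set0 -> S != B ->
  exists x y, [/\ x \in S, y \in B, y \notin S & e x y].

Lemma sum_outdeg_in (B : {set T}) :
  (\sum_(x in B) outdeg_in B x).*2 = #|B| * #|B|.-1.
Proof.
have outE x : outdeg_in B x = \sum_(y in B) e x y.
  by rewrite /outdeg_in -sum1dep_card big_mkcondr; apply: eq_bigr => y _; case: e.
under eq_bigr => x _ do rewrite outE.
(* The doubled sum counts out-edges and in-edges together; each [x] in [B] then contributes 1 for
   every other vertex of [B]. *)
rewrite -addnn {2}exchange_big -big_split /= -sum_nat_const.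
apply: eq_bigr => x xB; rewrite -big_split /= (bigD1 x) //= tournament_irr add0n.
rewrite (cardD1 x) xB /= -sum1_card; apply: eq_big => [y | y /andP[_ yx]].
  by rewrite !inE andbC.
by have [_ /(_ y x yx)] := he; case: (e x y); case: (e y x).
Qed.

(** The average out-degree inside [B] is (|B| - 1) / 2. *)
Lemma min_outdeg_in_card d (B : {set T}) :
  min_outdeg_in_ge d B -> d.*2 < #|B|.
Proof.
case/andP=> B0 /forall_inP dB.
have B_gt0 : 0 < #|B| by rewrite card_gt0.
have: \sum_(x in B) d <= \sum_(x in B) outdeg_in B x by apply: leq_sum.
rewrite -leq_double sum_outdeg_in sum_nat_const doubleMr leq_pmul2l //; lia.
Qed.

(** In an inclusion-minimal [B], a nonempty subset [S] that no edge leaves keeps all its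
    out-neighbours in [B], hence the bound [d], so it is all of [B]. *)
Lemma strong_subset d (A : {set T}) :
  min_outdeg_in_ge d A ->
  exists2 B : {set T}, B \subset A & min_outdeg_in_ge d B /\ strong B.
Proof.
move=> dA; have [B /minsetP[dB minB] BA] := minset_exists dA.
exists B => //; split=> // S SB S0 SnB.
case: (boolP [exists x in S, exists y in B, (y \notin S) && e x y]).
  case/exists_inP=> x xS /exists_inP[y yB /andP[yS exy]].
  by exists x, y.
move=> closedS; case/negP: SnB; apply/eqP/minB => //.
rewrite /min_outdeg_in_ge S0; apply/forall_inP => x xS.
case/andP: dB => _ /forall_inP/(_ _ (subsetP SB x xS))/leq_trans; apply.
apply/subset_leq_card/subsetP => y; rewrite !inE => /andP[yB exy].
rewrite exy andbT; apply: contraNT closedS => yS.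
by apply/exists_inP; exists x => //; apply/exists_inP; exists y; rewrite ?yS.
Qed.

(** Some edge goes from an out-neighbour [x] of [v] to a vertex [y] that [v] does not dominate; [y]
    is not [v] because [v] dominates [x], so [y] dominates [v]. *)
Lemma strong_triangle (B : {set T}) :
  strong B -> 1 < #|B| ->
  exists c : seq T, [/\ dicycle e c, {subset c <= B} & size c = 3].
Proof.
move=> stB B1; have /card_gt0P[v vB] : 0 < #|B| by lia.
have [||| _ [w [/set1P-> wB _ evw]]] := stB [set v].
- by rewrite sub1set.
- by rewrite -card_gt0 cards1.
- by apply: contraTneq B1 => <-; rewrite cards1.
have [||| x [y []]] := stB [set y in B | e v y].
- by apply/subsetP => y; rewrite inE => /andP[].
- by apply/set0Pn; exists w; rewrite inE wB.
- by apply/eqP => /setP/(_ v); rewrite !inE vB tournament_irr.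
rewrite !inE => /andP[xB evx] yB; rewrite yB /= => nevy exy.
have vy : v != y by apply: contraTneq exy => <-; rewrite tournament_asym.
exists [:: v; x; y]; split=> //.
  rewrite /dicycle /= evx exy tournament_total //= !inE negb_or vy.
  by rewrite !tournament_neq.
by move=> t; rewrite !inE => /or3P[] /eqP->.
Qed.

(** [z] goes right before the first vertex of [p] that it dominates; the vertex preceding that one
    dominates [z]. *)
Lemma path_insert z u p :
  path e u p -> z \notin p -> e u z -> e z (last u p) ->
  exists p', [/\ path e u p', last u p' = last u p & perm_eq p' (z :: p)].
Proof.
elim: p u => [|b p IHp] u /=; first by move=> _ _ /tournament_asym->.
rewrite inE negb_or => /andP[eub pbp] /andP[zb zp] euz ezl.
have [ezb | nezb] := boolP (e z b).
  by exists [:: z, b & p]; rewrite /= euz ezb.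
have [p' [bp' lp' pp']] := IHp b pbp zp (tournament_total zb nezb) ezl.
exists (b :: p'); split; rewrite /= ?eub //.
by apply/permP => a; have /permP/(_ a) := pp'; rewrite /= => ->; rewrite addnCA.
Qed.

Lemma dicycle_insert c z u w :
  dicycle e c -> z \notin c -> u \in c -> w \in c -> e u z -> e z w ->
  exists2 c', dicycle e c' & perm_eq c' (z :: c).
Proof.
case/and3P=> c0 cyc unc zc uc wc euz ezw.
case: (rot_to uc) => i p def_c.
have cp : perm_eq c (u :: p) by rewrite -def_c perm_sym perm_rot.
have wp : w \in p.
  move: wc; rewrite (perm_mem cp) inE => /predU1P[wu|//].
  by rewrite wu tournament_asym in ezw.
move: cyc unc (zc); rewrite -(rot_cycle i) def_c (perm_uniq cp) (perm_mem cp).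
case/splitPr: wp cp => {def_c} p1 p2 cp.
(* The stretch of the cycle from [u] to [w] becomes a path ending at [w], into which [z] is
   inserted. *)
rewrite -cat_rcons in cp *.
rewrite /= rcons_cat cat_path last_rcons => /andP[pu1 pw2] un.
rewrite inE mem_cat !negb_or => /and3P[zu zp1 zp2].
have [|p' [up' lp' pp']] := path_insert pu1 zp1 euz.
  by rewrite last_rcons.
have cp' : perm_eq (u :: p' ++ p2) (z :: c).
  apply/permP => a; have /permP/(_ a) := cp; have /permP/(_ a) := pp'.
  by rewrite /= !count_cat => -> ->; rewrite -addnA addnCA.
exists (u :: p' ++ p2) => //.
rewrite /dicycle /= rcons_cat cat_path up' lp' last_rcons pw2 /=.
by rewrite -[_ && _]/(uniq (u :: _)) (perm_uniq cp') /= zc (perm_uniq cp).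
Qed.

(* If no outside vertex can be inserted into c, each one either dominates c or
   is dominated by c; strong connectivity then gives an edge x -> y from a
   dominated vertex to a dominating one, and x, y replace one vertex of c. *)
Lemma strong_dicycle_succ (B : {set T}) c :
  strong B -> dicycle e c -> {subset c <= B} -> 1 < size c < #|B| ->
  exists c', [/\ dicycle e c', {subset c' <= B} & size c' = (size c).+1].
Proof.
move=> stB dc cB /andP[c1 cltB].
case: (boolP [exists z in B, (z \notin c) && (has (e^~ z) c && has (e z) c)]).
  case/exists_inP=> z zB /andP[zc /andP[/hasP[u uc euz] /hasP[w wc ezw]]].
  have [c' dc' pc'] := dicycle_insert dc zc uc wc euz ezw.
  exists c'; split; rewrite ?(perm_size pc') // => t.
  by rewrite (perm_mem pc') inE => /predU1P[->|/cB].
move=> noins.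
(* As no vertex can be inserted, one vertex of [c] dominating [z] means that all of them do. *)
pose S := [set z in B | (z \notin c) && has (e^~ z) c].
have domS x a : x \in S -> a \in c -> e a x.
  rewrite inE => /and3P[xB xc hx] ac; apply: tournament_total.
    by apply: contraNneq xc => ->.
  apply: contraNN noins => exa; apply/exists_inP; exists x => //.
  by rewrite xc hx; apply/hasP; exists a.
have [||| u [z [uc zB zc euz]]] := stB [set x in c].
- by apply/subsetP => x; rewrite inE => /cB.
- by apply/set0Pn; case: (c) c1 => // a r _; exists a; rewrite inE mem_head.
- apply: contraTneq cltB => <-; rewrite -leqNgt.
  by apply: leq_trans (card_size c); rewrite cardsE.
rewrite !inE in uc zc.
(* The head [y] of an edge leaving [S] is not in [c], since [c] dominates [x]; being outside [S]
   too, it dominates [c]. *)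
have [||| x [y [xS yB yS exy]]] := stB S.
- by apply/subsetP => x; rewrite inE => /andP[].
- by apply/set0Pn; exists z; rewrite inE zB zc; apply/hasP; exists u.
- by apply: contraTneq (cB u uc) => <-; rewrite inE uc andbF.
have yc : y \notin c.
  by apply: contraTN exy => yc; rewrite tournament_asym ?domS.
have domy a : a \in c -> e y a.
  move=> ac; apply: tournament_total; first by apply: contraNneq yc => <-.
  by apply: contraNN yS => eay; rewrite inE yB yc; apply/hasP; exists a.
have [xB xc] : x \in B /\ x \notin c by move: xS; rewrite inE => /and3P[].
have domx a : a \in c -> e a x by apply: domS.
have xy := tournament_neq exy.
move: dc cB c1 xc yc domx domy; clear -xB yB xy exy.
case: c => [|a [|b r]] // /and3P[_ /= /andP[_ pbr]].
rewrite !inE !negb_or => /and3P[/andP[_ ar] _ ur] cB _.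
case/and3P=> xa _ xr /and3P[ya _ yr] domx domy.
(* [x] and [y] replace the second vertex [b]; the successor of [y] is the head of [r], or [a] if [r]
   is empty. *)
exists [:: a, x, y & r]; split=> // [|t].
  rewrite /dicycle /= domx ?mem_head // exy !inE !negb_or.
  rewrite eq_sym xa eq_sym ya ar xy xr yr ur !andbT /=.
  case: r pbr domy {ar ur cB xr yr domx} => [|h r] /= => [_|/andP[_ ->]] -> //;
    by rewrite !inE eqxx ?orbT.
rewrite !inE => /or4P[/eqP->|/eqP->|/eqP->|tr] //; apply: cB.
  by rewrite mem_head.
by rewrite !inE tr !orbT.
Qed.

(** Moon's theorem: a triangle is lengthened by one vertex at a time. *)
Lemma strong_pancyclic (B : {set T}) m :
  strong B -> 3 <= m <= #|B| ->
  exists c : seq T, [/\ dicycle e c, {subset c <= B} & size c = m].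
Proof.
move=> stB; elim: m => // m IHm /andP[m2 mB].
have [m3 | m2'] := ltnP 2 m.
  have [|c [dc cB sc]] := IHm; first by rewrite m3 ltnW.
  have [|c' []] := strong_dicycle_succ stB dc cB; first by rewrite sc mB ltnW.
  by rewrite sc; exists c'.
have -> : m.+1 = 3 by apply/eqP; rewrite eqn_leq ltnS m2' m2.
by apply: strong_triangle stB _; apply: leq_trans mB; apply: ltnW.
Qed.

Lemma min_outdeg_le x : min_outdeg e <= outdeg e x.
Proof.
rewrite /min_outdeg; have := mem_index_enum x.
elim: (index_enum T) => // y s IHs; rewrite inE big_cons geq_min.
by case/predU1P=> [-> | /IHs->]; rewrite ?leqnn ?orbT.
Qed.

(** Ensures that vertices remain once fewer than [min_outdeg e] of them are removed. *)
Lemma min_outdeg_card : min_outdeg e <= #|T|.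
Proof.
rewrite /min_outdeg; apply: (big_ind (fun m => m <= #|T|)) => [//|m n mT _|x _].
  by rewrite geq_min mT.
exact: max_card.
Qed.

Lemma min_outdeg_in_setC (U : {set T}) :
  #|U| < min_outdeg e -> min_outdeg_in_ge (min_outdeg e - #|U|) (~: U).
Proof.
move=> Ud; apply/andP; split.
  by rewrite -card_gt0 cardsCs setCK subn_gt0 (leq_trans Ud) ?min_outdeg_card.
apply/forall_inP => x _; apply: leq_trans (leq_sub2r _ (min_outdeg_le x)) _.
have -> : outdeg_in (~: U) x = #|[set y | e x y] :\: U|.
  by apply: eq_card => y; rewrite !inE.
by rewrite cardsD leq_sub2l ?subset_leq_card ?subsetIr.
Qed.

Lemma sumn_iota3 k : (sumn (iota 3 k)).*2 = k ^ 2 + 5 * k.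
Proof.
elim: k => // k IHk.
by rewrite -{1}[k.+1]addn1 iotaD sumn_cat doubleD IHk /=; lia.
Qed.

(** The degree bound is doubled and cleared of subtraction so that it is faithful in [nat]. *)
Lemma disjoint_dicycles k :
  k ^ 2 + 4 * k <= (min_outdeg e).*2 + 3 ->
  exists cs : seq (seq T),
    [/\ all (dicycle e) cs, map size cs = iota 3 k
      & pairwise (fun c c' : seq T => [disjoint c & c']) cs].
Proof.
elim: k => [_|k IHk dk]; first by exists [::].
have [|cs [dcs szs disj]] := IHk; first by apply: leq_trans dk; lia.
pose U := [set x in flatten cs].
have UB : #|U|.*2 <= k ^ 2 + 5 * k.
  rewrite -sumn_iota3 -szs -[map size cs]/(shape cs) -size_flatten leq_double.
  by rewrite cardsE card_size.
(* The hypothesis for [k.+1] is k^2 + 6k + 2 <= 2 [min_outdeg e], so 2 ([min_outdeg e] - |U|) >= k +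
   2; this will give [B] at least k + 3 vertices. *)
have Ud : #|U| < min_outdeg e by lia.
have [B BU [dB stB]] := strong_subset (min_outdeg_in_setC Ud).
have /= dltB := min_outdeg_in_card dB.
have [|c [dc cB sc]] := @strong_pancyclic B (3 + k) stB; first by lia.
exists (rcons cs c); split.
- by rewrite all_rcons dc.
- by rewrite map_rcons szs sc -cats1 -(iotaD 3 k 1) addn1.
- rewrite pairwise_rcons disj andbT; apply/allP => c' c's.
  rewrite disjoint_sym; apply/pred0P => x /=; apply/negP => /andP[xc xc'].
  have /(subsetP BU) := cB x xc; rewrite !inE => /negP; apply.
  by apply/flattenP; exists c'.
Qed.

End Tournament.

Local Open Scope ring_scope.

Theorem theorem3p4 (k : nat) (hk : (1 <= k)%N) (T : finType) (e : rel T)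
    (he : tournament e)
    (hd : (k%:R ^+ 2 + 4 * k%:R - 3) / 2 <= (min_outdeg e)%:R :> rat) :
  exists C : 'I_k -> seq T,
    (forall i : 'I_k, dicycle e (C i)) /\
    (forall i j : 'I_k, i != j ->
       [disjoint C i & C j] /\ size (C i) <> size (C j)).
Proof.
have hd_nat : (k ^ 2 + 4 * k <= (min_outdeg e).*2 + 3)%N.
  rewrite -(ler_nat rat) -muln2 natrD natrX natrM [leRHS]natrD natrM.
  by move: hd; rewrite ler_pdivrMr ?ltr0n // lerBlDr.
have [cs [dcs szs disj]] := disjoint_dicycles he hd_nat.
have sz : size cs = k by rewrite -(size_map size) szs size_iota.
have szC i : (i < k)%N -> size (nth [::] cs i) = (3 + i)%N.
  by move=> ik; rewrite -(nth_map _ 0%N) ?sz // szs nth_iota.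
have disjC i j : (i < j < k)%N -> [disjoint nth [::] cs i & nth [::] cs j].
  case/andP=> ij jk; move/(pairwiseP [::]): disj; apply=> //.
    by rewrite inE sz (ltn_trans ij).
  by rewrite inE sz.
exists (fun i : 'I_k => nth [::] cs i); split=> [i | i j ij].
  by apply: (allP dcs); rewrite mem_nth ?sz.
split; last by rewrite !szC // => /addnI/val_inj/eqP; rewrite (negPf ij).
have [lt_ij | lt_ji | /val_inj/eqP] := ltngtP i j; last by rewrite (negPf ij).
  by apply: disjC; rewrite lt_ij /=.
by rewrite disjoint_sym; apply: disjC; rewrite lt_ji /=.
Qed.
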